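(* Let $R$ be a weakly reversible ring. Then $R$ is a McCoy ring.
   Context: All rings are associative with identity, not necessarily commutative. In $R[x]$ the indeterminate $x$ commutes with the elements of $R$. For $a\in R$, $r_R(a)=\{b\in R: ab=0\}$ and $l_R(a)=\{b\in R: ba=0\}$. An element $a\in R$ is reversible if $l_R(a)=r_R(a)$. A ring $R$ is weakly reversible if for each non-zero $a\in R$ there is an integer $m>0$ such that $a^m$ is a non-zero reversible element of $R$. A ring $R$ is right McCoy if, for all non-zero $f(x),g(x)\in R[x]$ with $f(x)g(x)=0$, there is a non-zero $c\in R$ with $f(x)c=0$. Left McCoy is defined dually: for all non-zero $f(x),g(x)\in R[x]$ with $f(x)g(x)=0$, there is a non-zero $c\in R$ with $c\,g(x)=0$. A ring is McCoy if it is both left and right McCoy. *)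

(* Defs.v *)
From HB Require Import structures.
From mathcomp Require Import all_boot all_order all_algebra.
Set Implicit Arguments.
Unset Strict Implicit.
Unset Printing Implicit Defensive.
Import GRing.Theory.
Local Open Scope ring_scope.

(* nzRingType requires 1 != 0; over the zero ring weak reversibility and the McCoy
   conditions hold vacuously, as there is no non-zero element or polynomial. *)
Definition r_ann (R : nzRingType) (a : R) : {pred R} := [pred b | a * b == 0].

Definition l_ann (R : nzRingType) (a : R) : {pred R} := [pred b | b * a == 0].

Definition reversible_elt (R : nzRingType) (a : R) : Prop :=
  l_ann a =i r_ann a.

Definition weakly_reversible (R : nzRingType) : Prop :=
  forall a : R, a != 0 ->
    exists m : nat, [/\ (0 < m)%N, a ^+ m != 0 & reversible_elt (a ^+ m)].

Definition right_McCoy (R : nzRingType) : Prop :=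
  forall f g : {poly R}, f != 0 -> g != 0 -> f * g = 0 ->
    exists2 c : R, c != 0 & f * c%:P = 0.

Definition left_McCoy (R : nzRingType) : Prop :=
  forall f g : {poly R}, f != 0 -> g != 0 -> f * g = 0 ->
    exists2 c : R, c != 0 & c%:P * g = 0.

Definition McCoy (R : nzRingType) : Prop := left_McCoy R /\ right_McCoy R.

(* Main.v *)
(** Let [f * g = 0] with [g] of least size, and let [b] be the leading
    coefficient of [g].  The annihilator of a reversible element is a two-sided
    ideal, so the equations for the coefficients of [f * g], read from the top,
    show that each coefficient of [f] kills a power of [b]; if [b] is not
    nilpotent, a high power of [b] therefore kills [f].  If [b] is nilpotent,
    multiplying [g] on the right by a power of [b] gives [b ^+ 2 = 0].
    Minimality of [g] forces every [t] with [b * t = 0] to satisfy [g * t = 0].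
    Hence [g * b = 0], so [b] kills the coefficients of [g] on either side, so
    these have pairwise product zero; being of square zero they are reversible,
    and then, from the top down, the coefficients of [f] annihilate [g].
    Left McCoy is right McCoy over the opposite ring. *)
Require Import Defs.
From mathcomp Require Import all_boot all_order all_algebra.
Import GRing.Theory.
Local Open Scope ring_scope.

Section WeaklyReversible.
Variable R : nzRingType.
Implicit Types (a b c t x y z : R) (f g : {poly R}).

Lemma reversible_eltP a :
  reversible_elt a <-> forall b, (b * a == 0) = (a * b == 0).
Proof. by split=> h b; move: (h b); rewrite !inE. Qed.

Lemma reversible_mul0 x y z :
  reversible_elt z -> x * z = 0 -> x * y * z = 0.
Proof.
move=> /reversible_eltP zrev /eqP; rewrite zrev => /eqP zx0.
by apply/eqP; rewrite zrev mulrA zx0 mul0r.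
Qed.

(** Compare coefficients in degree [i + (size g).-1]: terms with [k > i] die by hypothesis, those
    with [k < i] reach past the leading coefficient of [g]. *)
Lemma mul_poly_top f g i t : f * g = 0 ->
  (forall k j, (i < k)%N -> f`_k * g`_j * t = 0) -> f`_i * lead_coef g * t = 0.
Proof.
move=> fg0 high0; pose n := (size g).-1.
have ltin : (i < (i + n).+1)%N by rewrite ltnS leq_addr.
have := congr1 (fun p : {poly R} => p`_(i + n) * t) fg0.
rewrite /= coef0 mul0r coefM mulr_suml (bigD1 (Ordinal ltin)) //= addKn big1.
  by rewrite addr0.
move=> k neq_ki; have [lt_ik|lt_ki|eq_ik] := ltngtP i k.
- exact: high0.
- rewrite [g`_ _]nth_default ?mulr0 ?mul0r //.
  rewrite -(leq_add2l k) subnKC; last by rewrite -ltnS.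
  by rewrite (leq_trans (leq_add (leqnn k) (leqSpred _))) // addnS ltn_add2r.
- by case/eqP: neq_ki; apply: val_inj.
Qed.

Hypothesis hR : weakly_reversible R.

(** For [x != 0] all powers beyond the first vanish, so the reversible power must be [x] itself. *)
Lemma sqr0_reversible x : x * x = 0 -> reversible_elt x.
Proof.
move=> xx0; have [->|x0] := eqVneq x 0.
  by apply/reversible_eltP=> b; rewrite mulr0 mul0r.
have [[|[|m]] [m_gt0 xm0 xrev]] := hR _ x0; [by [] | by [] |].
by rewrite !exprS mulrA xx0 mul0r eqxx in xm0.
Qed.

Lemma lead_coef_nilpotent_or_ann f g : f * g = 0 ->
  (exists k, lead_coef g ^+ k = 0) \/
  (exists2 c, c != 0 & forall i, f`_i * c = 0).
Proof.
move=> fg0; set b := lead_coef g.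
(* A single non-zero power of [b] is to kill the top [s] coefficients of [f]. *)
suff top s : (exists k, b ^+ k = 0) \/ (exists2 k, b ^+ k != 0 &
    forall i, (size f <= i + s)%N -> f`_i * b ^+ k = 0).
  have [|[k bk0 fbk]] := top (size f); first by left.
  by right; exists (b ^+ k) => // i; apply: fbk; rewrite leq_addl.
elim: s => [|s [|[k bk0 fbk]]]; last 2 first.
- by left.
(* Passing to a reversible power lets coefficients of [g] be inserted before it. *)
- have [[|m] [m_gt0 bkm0 rev_bkm]] := hR _ bk0; first by [].
  have fbkm i : (size f <= i + s)%N -> f`_i * b ^+ k ^+ m.+1 = 0.
    by move=> /fbk fi0; rewrite exprS mulrA fi0 mul0r.
  set d := b ^+ k ^+ m.+1 in bkm0 rev_bkm fbkm.
  have bdE : b * d = b ^+ (k * m.+1).+1 by rewrite exprS exprM.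
  have [bd0|bd0] := eqVneq (b * d) 0;
    first by left; exists (k * m.+1).+1; rewrite -bdE.
  right; exists (k * m.+1).+1 => [|i les]; rewrite -bdE // mulrA.
  apply: mul_poly_top => // j l lt_ij; apply: reversible_mul0 => //.
  by apply: fbkm; rewrite (leq_trans les) // addnS -addSn leq_add2r.
- right; exists 0%N => [|i]; first by rewrite expr0 oner_neq0.
  by rewrite addn0 => les; rewrite nth_default ?mul0r.
Qed.

(** The third hypothesis encodes minimality of [g]; testing only a finite list of [t] makes it
    decidable. *)
Lemma sqr0_lead_coef_ann f g : f * g = 0 -> lead_coef g * lead_coef g = 0 ->
  (forall t, t \in lead_coef g :: g ++ f -> lead_coef g * t = 0 ->
     forall j, g`_j * t = 0) ->
  forall i, f`_i * lead_coef g = 0.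
Proof.
set b := lead_coef g => fg0 bb0 min_g.
have /reversible_eltP b_rev := sqr0_reversible _ bb0.
have g_ann t : t \in g ++ f -> t * b = 0 -> forall j, g`_j * t = 0.
  move=> t_gf /eqP; rewrite b_rev => /eqP; apply: min_g.
  by rewrite inE t_gf orbT.
have gb0 j : g`_j * b = 0 by apply: min_g; rewrite ?mem_head.
have gg0 j : g`_j * g`_j = 0.
  have [gj|lej] := ltnP j (size g); last by rewrite nth_default // mulr0.
  by apply: g_ann => //; rewrite mem_cat mem_nth.
suff top s i : (size f <= i + s)%N -> forall j, f`_i * g`_j = 0.
  by move=> i; apply: (top (size f)); rewrite leq_addl.
elim: s i => [|s IHs] i les j.
  by rewrite nth_default ?mul0r // -[i]addn0.
have fib0 : f`_i * b = 0.
  rewrite -[LHS]mulr1; apply: mul_poly_top => // k l lt_ik.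
  by rewrite mulr1 IHs // (leq_trans les) // addnS -addSn leq_add2r.
have [lti|lei] := ltnP i (size f); last by rewrite nth_default // mul0r.
(* From [fib0], [g_ann] yields only [g_j * f_i = 0]; reversibility of [g_j] swaps the factors. *)
have /reversible_eltP gj_rev := sqr0_reversible _ (gg0 j).
apply/eqP; rewrite gj_rev; apply/eqP/g_ann => //.
by rewrite mem_cat mem_nth ?orbT.
Qed.

Lemma size_lead_coef_mul_polyC g t : lead_coef g * t != 0 ->
  size (g * t%:P) = size g /\ lead_coef (g * t%:P) = lead_coef g * t.
Proof.
move=> gt0; have t0 : t != 0 by apply: contraNneq gt0 => ->; rewrite mulr0.
split; last by rewrite lead_coef_proper_mul ?lead_coefC.
by rewrite size_proper_mul ?lead_coefC // size_polyC t0 addn1.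
Qed.

Lemma size_mul_polyC_lt g t : g != 0 -> lead_coef g * t = 0 ->
  (size (g * t%:P)%R < size g)%N.
Proof.
move=> g0 gt0; have g_gt0 : (0 < size g)%N by rewrite size_poly_gt0.
rewrite -[X in (_ < X)%N](prednK g_gt0) ltnS; apply/leq_sizeP => j lej.
rewrite coefMC; move: lej; rewrite leq_eqVlt => /predU1P[<- //|].
by rewrite prednK // => lej; rewrite nth_default ?mul0r.
Qed.

Lemma nilpotent_last_power x : x != 0 -> (exists k, x ^+ k = 0) ->
  exists p, x * x ^+ p != 0 /\ x * x ^+ p.+1 = 0.
Proof.
move=> x0 [k xk0]; have xn0 : exists n, x * x ^+ n == 0.
  by exists k; rewrite xk0 mulr0.
case: (ex_minnP xn0) => [[|p] /eqP xp0 min_p].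
  by move: x0; rewrite -[x]mulr1 -(expr0 x) xp0 eqxx.
by exists p; split=> //; apply/negP => /min_p; rewrite ltnn.
Qed.

Lemma coef_ann f g : g != 0 -> f * g = 0 ->
  exists2 c, c != 0 & forall i, f`_i * c = 0.
Proof.
have [n] := ubnP (size g); elim: n g => // n IHn g.
rewrite ltnS => le_gn g0 fg0.
have [b_nil|//] := lead_coef_nilpotent_or_ann _ _ fg0.
have b0 : lead_coef g != 0 by rewrite lead_coef_eq0.
have [p [bp0 bpS0]] := nilpotent_last_power _ b0 b_nil.
(* With [b] the leading coefficient of [g], that of [h] is [b ^+ p.+1 != 0], while
   [b ^+ p.+2 = 0]. *)
pose h := g * (lead_coef g ^+ p)%:P.
have [size_h lead_h] : size h = size g /\ lead_coef h = _ :=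
  size_lead_coef_mul_polyC _ _ bp0.
have fh0 : f * h = 0 by rewrite mulrA fg0 mul0r.
have h0 : h != 0 by rewrite -lead_coef_eq0 lead_h.
have bb0 : lead_coef h * lead_coef h = 0.
  rewrite -exprS in bpS0.
  by rewrite lead_h -exprS -exprD addSnnS addnC exprD bpS0 mul0r.
have [/allP min_h|/allPn[t _]] := boolP
    (all (fun t => (lead_coef h * t == 0) ==> (h * t%:P == 0))
         (lead_coef h :: h ++ f)).
  exists (lead_coef h); first by rewrite lead_h.
  apply: sqr0_lead_coef_ann => // t /min_h /implyP ht /eqP /ht /eqP ht0 j.
  by rewrite -coefMC ht0 coef0.
(* A failing [t] makes [h * t%:P] a shorter non-zero polynomial annihilated by [f]. *)
rewrite negb_imply => /andP[/eqP bt0 ht0]; apply: (IHn (h * t%:P)) => //.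
  by apply: leq_trans le_gn; rewrite -size_h size_mul_polyC_lt.
by rewrite mulrA fh0 mul0r.
Qed.

End WeaklyReversible.

Lemma weakly_reversible_converse (R : nzRingType) :
  weakly_reversible R -> weakly_reversible R^c.
Proof.
move=> hR a a0; have [m [m0 am0 arev]] := hR a a0.
have powE k : (a : R^c) ^+ k = (a : R) ^+ k.
  by elim: k => // k IHk; rewrite exprS IHk exprSr.
(* [l_ann] and [r_ann] are exchanged in [R^c], so the last goal is [arev] by
   symmetry. *)
by exists m; split; rewrite ?powE.
Qed.

Theorem corollary2p19 (R : nzRingType) (hR : weakly_reversible R) : McCoy R.
Proof.
split=> f g f0 g0 fg0.
- pose f' : {poly R^c} := @Poly R^c (f : seq R).
  pose g' : {poly R^c} := @Poly R^c (g : seq R).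
  have f'E i : f'`_i = f`_i by rewrite coef_Poly.
  have g'E i : g'`_i = g`_i by rewrite coef_Poly.
  have f'0 : f' != 0.
    apply: contra_neq f0 => f'0; apply/polyP => i.
    by rewrite -f'E f'0 !coef0.
  have gf0 : g' * f' = 0.
    apply/polyP => i; rewrite coefM coef0.
    have := congr1 (fun p : {poly R} => p`_i) fg0.
    (* [coefMr] indexes the sum by the coefficients of [g], matching [g' * f'] over [R^c] term by
       term. *)
    rewrite /= coefMr coef0 => fgi; rewrite -[RHS]fgi.
    by apply: eq_bigr => j _; rewrite f'E g'E.
  have [c c0 gc0] := coef_ann _ (weakly_reversible_converse _ hR) _ _ f'0 gf0.
  exists (c : R) => //; apply/polyP => i.
  by rewrite coefCM coef0 -g'E; apply: gc0.
- have [c c0 fc0] := coef_ann _ hR _ _ g0 fg0.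
  by exists c => //; apply/polyP => i; rewrite coefMC coef0.
Qed.
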